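(* For $n=4$, the algorithm for Shifted Combinatorial Optimization over independence systems presented by a linear optimization oracle that is described in the context has approximation ratio $\frac{2625}{6692}\sim 0.392259$: for every independence system $S\subseteq\{0,1\}^d$ and every $c\in\mathbb{Z}^{d\times 4}$, it returns a matrix $y\in S^4$ with $c\,\overline{y}\ge \frac{2625}{6692}\max\{c\,\overline{z} : z\in S^4\}$.
   Context: For a matrix $x$, $x^j$ denotes its $j$-th column. $S^n$ is the set of $d\times n$ matrices all of whose columns lie in $S$. The shift $\overline{x}$ of $x$ is the unique matrix obtained by permuting entries within each row so that each row is nonincreasing; $cx:=\sum_{i,j}c_{i,j}x_{i,j}$. Shifted Combinatorial Optimization (SCO): given $S\subseteq\{0,1\}^d$ and $c\in\mathbb{Z}^{d\times n}$, solve $\max\{c\,\overline{x}:x\in S^n\}$. $S$ is an independence system if $0\in S$ and $u\le v\in S$, $u\in\{0,1\}^d$ imply $u\in S$. A linear optimization oracle for $S$, queried on $w\in\mathbb{Z}^d$, returns $s\in S$ maximizing $ws$. An algorithm has approximation ratio $\alpha\le 1$ if it always returns a feasible solution with objective value at least $\alpha$ times the optimum. Disjoint Union Problem (DUP) with $k$ columns and weights $w\in\mathbb{Z}^d$: $\max\{w\sum_{j=1}^k x^j : x\in S^k,\ \sum_{j=1}^k x^j\in\{0,1\}^d\}$. Greedy algorithm for DUP: successively for $r=1,\dots,k$ query the oracle on the weights obtained from $w$ by setting to $0$ the weights of elements covered by previously obtained vectors, obtaining $x^r\in S$; then in each row of $[x^1,\dots,x^k]$ change all $1$'s but the first to $0$.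 It has approximation ratio $1-(1-\frac1k)^k$ for DUP with $k$ columns (so $\frac{175}{256}$ for $k=4$, $\frac34$ for $k=2$, and it is exact for $k=1$). Cleaning procedure applied to $x\in S^n$: for each $i\in\{1,\dots,d\}$ let $m(i,x)=\sum_j x_{i,j}$ and let $p(i,x)$ be a maximizer of $\sum_{j=1}^{r}c_{i,j}$ over $0\le r\le m(i,x)$; replace exactly $m(i,x)-p(i,x)$ of the $1$'s in row $i$ of $x$ by $0$'s. The algorithm for $n=4$ constructs three candidate solutions, for $\ell=0,1,2$ with $k(0)=4$, $k(1)=2$, $k(2)=1$, and returns the one with largest objective value $c\,\overline{x}$. Candidate $\ell$: apply the greedy algorithm to DUP with $k(\ell)$ columns and weights $w_i=\max_{0\le q\le 2^\ell}\sum_{j=1}^q c_{i,j}$ (for $\ell=2$ this is a single oracle call solving DUP exactly), take $2^\ell$ copies of each of the $k(\ell)$ resulting columns to get a $d\times 4$ matrix, and apply the cleaning procedure to it. *)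

(* Defs.v *)
From HB Require Import structures.
From mathcomp Require Import all_boot all_order all_algebra.

Set Implicit Arguments.
Unset Strict Implicit.
Unset Printing Implicit Defensive.

Import Order.TTheory GRing.Theory Num.Theory.
Local Open Scope ring_scope.

(* Vectors of {0,1}^d are Boolean column vectors; [S] is a finite set of them. *)

Definition independence_system (d : nat) (S : {set 'cV[bool]_d}) : Prop :=
  const_mx false \in S /\
  forall u v : 'cV[bool]_d,
    (forall i, u i ord0 ==> v i ord0) -> v \in S -> u \in S.

(* [x] belongs to S^n. *)
Definition all_cols_in (d n : nat) (S : {set 'cV[bool]_d}) (x : 'M[bool]_(d, n))
  : bool :=
  [forall j, col j x \in S].

(* The entries of each row sorted nonincreasingly; the default value [x i j] of
   [nth] is never used. *)
Definition shift (disp : Order.disp_t) (T : orderType disp) (d n : nat)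
    (x : 'M[T]_(d, n)) : 'M[T]_(d, n) :=
  \matrix_(i, j) nth (x i j) (sort >=%O [seq x i k | k <- enum 'I_n]) j.

Definition entry_dot (d n : nat) (c : 'M[int]_(d, n)) (x : 'M[bool]_(d, n)) : int :=
  \sum_i \sum_j c i j * (x i j)%:R.

Definition sco_obj (d n : nat) (c : 'M[int]_(d, n)) (x : 'M[bool]_(d, n)) : int :=
  entry_dot c (shift x).

(* The starting value 0 of the maximum is the objective value of the zero
   matrix, which lies in S^n when S is an independence system. *)
Definition sco_opt (d n : nat) (S : {set 'cV[bool]_d}) (c : 'M[int]_(d, n)) : int :=
  \big[Num.max/0]_(z : 'M[bool]_(d, n) | all_cols_in S z) sco_obj c z.

Definition linear_opt_oracle (d : nat) (S : {set 'cV[bool]_d})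
    (oracle : 'cV[int]_d -> 'cV[bool]_d) : Prop :=
  forall w, oracle w \in S /\ forall s, s \in S -> entry_dot w s <= entry_dot w (oracle w).

Definition uncovered_weights (d : nat) (w : 'cV[int]_d) (xs : seq 'cV[bool]_d)
  : 'cV[int]_d :=
  \col_i if has (fun x : 'cV[bool]_d => x i ord0) xs then 0 else w i ord0.

Fixpoint greedy_answers (d : nat) (oracle : 'cV[int]_d -> 'cV[bool]_d)
    (w : 'cV[int]_d) (k : nat) : seq 'cV[bool]_d :=
  if k is r.+1 then
    let xs := greedy_answers oracle w r in
    rcons xs (oracle (uncovered_weights w xs))
  else [::].

Definition keep_first_ones (d k : nat) (x : 'M[bool]_(d, k)) : 'M[bool]_(d, k) :=
  \matrix_(i, j) (x i j && ~~ [exists j' : 'I_k, (j' < j)%N && x i j']).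

Definition dup_greedy (d : nat) (oracle : 'cV[int]_d -> 'cV[bool]_d)
    (w : 'cV[int]_d) (k : nat) : 'M[bool]_(d, k) :=
  keep_first_ones
    (\matrix_(i, j) nth (const_mx false) (greedy_answers oracle w k) j i ord0).

(* c_{i,1} + ... + c_{i,r}, for r <= n. *)
Definition prefix_sum (d n : nat) (c : 'M[int]_(d, n)) (i : 'I_d) (r : nat) : int :=
  \sum_(j < n | (j < r)%N) c i j.

(* w_i is the maximum of the prefix sums over 0 <= r <= q; the starting value 0
   is the prefix sum for r = 0. *)
Definition dup_weights (d n : nat) (c : 'M[int]_(d, n)) (q : nat) : 'cV[int]_d :=
  \col_i \big[Num.max/0]_(r < q.+1) prefix_sum c i r.

Lemma copied_col_subproof (k q : nat) (j : 'I_(k * q)) : (j %/ q < k)%N.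
Proof.
case: q j => [|q] j; last by rewrite ltn_divLR.
by case: j => j; rewrite muln0.
Qed.

(* [q] consecutive copies of each column of [x]. *)
Definition copy_cols (d k q : nat) (x : 'M[bool]_(d, k)) : 'M[bool]_(d, k * q) :=
  \matrix_(i, j) x i (Ordinal (copied_col_subproof j)).

Definition row_ones (d n : nat) (x : 'M[bool]_(d, n)) (i : 'I_d) : nat :=
  (\sum_j x i j)%N.

(* [y] is a possible result of the cleaning procedure on [x]: both the maximizer
   p and the 1's that are replaced by 0's may be chosen arbitrarily. *)
Definition cleaning (d n : nat) (c : 'M[int]_(d, n)) (x y : 'M[bool]_(d, n))
  : Prop :=
  forall i, exists p : nat,
    [/\ (p <= row_ones x i)%N,
        forall r : nat, (r <= row_ones x i)%N -> prefix_sum c i r <= prefix_sum c i p,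
        forall j, y i j ==> x i j
      & #|[set j | x i j && ~~ y i j]| = (row_ones x i - p)%N].

Definition candidate (d k l : nat) (oracle : 'cV[int]_d -> 'cV[bool]_d)
    (c : 'M[int]_(d, k * 2 ^ l)) (y : 'M[bool]_(d, k * 2 ^ l)) : Prop :=
  cleaning c (copy_cols (2 ^ l) (dup_greedy oracle (dup_weights c (2 ^ l)) k)) y.

(* [y] is a possible output of the algorithm for n = 4, over all choices made in
   the cleaning procedure and all ties between best candidates.  The types
   'M_(d, 4 * 2 ^ 0), 'M_(d, 2 * 2 ^ 1) and 'M_(d, 1 * 2 ^ 2) are all
   convertible to 'M_(d, 4). *)
Definition sco4_output (d : nat) (oracle : 'cV[int]_d -> 'cV[bool]_d)
    (c : 'M[int]_(d, 4)) (y : 'M[bool]_(d, 4)) : Prop :=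
  exists y0 y1 y2 : 'M[bool]_(d, 4),
    [/\ @candidate d 4 0 oracle c y0,
        @candidate d 2 1 oracle c y1,
        @candidate d 1 2 oracle c y2,
        y \in [:: y0; y1; y2]
      & forall y', y' \in [:: y0; y1; y2] -> sco_obj c y' <= sco_obj c y].

(* Main.v *)
Require Import Defs.
From mathcomp Require Import all_boot all_order all_algebra.
From mathcomp Require Import zify lra ring.

Set Implicit Arguments.
Unset Strict Implicit.
Unset Printing Implicit Defensive.

Import Order.TTheory GRing.Theory Num.Theory.
Local Open Scope ring_scope.

(** For any finite list of vectors, the oracle gains in one greedy step at least
    1/k of the missing weight, which gives the ratio 1 - (1 - 1/k)^k for the
    weight covered by k arbitrary members of S.  The objective value of a
    cleaned candidate is exactly this covered weight.  Write w0 <= w1 <= w2 for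
    the three weights of a row, and let m be the number of ones of the row in a
    feasible z.  Averaging over the 6 pairs and the 4 single columns of z, the
    row counts with weights (7 [m > 0]) w0 in the first problem, (0, 3, 5, 6, 6) w1
    in the second and 5 m w2 in the third, with total at least 15 times its
    contribution to the value of z.  Weighting the greedy bounds 175/256, 3/4, 1
    accordingly gives 7/15 * 256/175 + 6/15 * 4/3 + 20/15 = 6692/2625. *)

(** * Shifted rows and the objective as a sum of prefix sums *)

Lemma nth_sorted_ge_bool (s : seq bool) (b : bool) (j : nat) :
  sorted >=%O s -> (j < size s)%N -> nth b s j = (j < count id s)%N.
Proof.
rewrite sorted_pairwise; last exact: ge_trans.
elim: s j => [|a s IH] [|j] //=; case/andP=> /allP a_ge s_sorted j_lt.
  (* A [false] head of a nonincreasing list forces the whole tail to be [false]. *)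
  case: a a_ge => //= /(_ true) s_false.
  by rewrite add0n -has_count; apply/esym/negbTE/hasPn => -[] // /s_false.
rewrite IH //; case: a a_ge => //= a_ge; rewrite add0n.
suff -> : count id s = 0%N by [].
by apply/eqP; rewrite -leqn0 leqNgt -has_count; apply/hasPn => -[] // /a_ge.
Qed.

Lemma row_onesE (d n : nat) (x : 'M[bool]_(d, n)) (i : 'I_d) :
  row_ones x i = #|[set j | x i j]|.
Proof.
rewrite /row_ones -sum1_card big_mkcond [RHS]big_mkcond /=.
by apply: eq_bigr => j _; rewrite inE; case: (x i j).
Qed.

Lemma shiftE (d n : nat) (x : 'M[bool]_(d, n)) (i : 'I_d) (j : 'I_n) :
  shift x i j = (j < row_ones x i)%N.
Proof.
rewrite mxE nth_sorted_ge_bool; last 2 first.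
- by apply: sort_sorted => a b; exact: ge_total.
- by rewrite size_sort size_map size_enum_ord.
by rewrite count_sort count_map -sum1_count big_enum_cond big_mkcond.
Qed.

(** A shifted row has its ones in the leading columns, so the objective sees [x] only through its
    row counts. *)
Lemma sco_objE (d n : nat) (c : 'M[int]_(d, n)) (x : 'M[bool]_(d, n)) :
  sco_obj c x = \sum_i prefix_sum c i (row_ones x i).
Proof.
apply: eq_bigr => i _; rewrite /prefix_sum [RHS]big_mkcond.
by apply: eq_bigr => j _; rewrite shiftE; case: ifP; rewrite ?mulr1 ?mulr0.
Qed.

(** * Row counts after copying columns and after keeping first ones *)

Lemma row_ones_copy_cols (d k q : nat) (x : 'M[bool]_(d, k)) (i : 'I_d) :
  row_ones (copy_cols q x) i = (q * row_ones x i)%N.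
Proof.
(* [F] extends row [i] of [x] by 0 to all naturals, so that the sum over [k * q] columns splits into
   [k] blocks of length [q] on which the quotient by [q] is constant. *)
pose F (m : nat) : nat := if insub m is Some j then x i j else 0%N.
have -> : row_ones x i = (\sum_(0 <= m < k) F m)%N.
  by rewrite big_mkord; apply: eq_bigr => j _; rewrite /F valK.
have -> : row_ones (copy_cols q x) i = (\sum_(0 <= m < k * q) F (m %/ q))%N.
  rewrite big_mkord; apply: eq_bigr => j _.
  rewrite mxE /F; case: insubP => [u _ u_val|]; last by rewrite copied_col_subproof.
  by congr (nat_of_bool (x i _)); apply: val_inj.
rewrite big_nat_mul big_distrr /=; apply: eq_bigr => m _.
rewrite (eq_big_nat _ _ (F2 := fun=> F m)) => [|j /andP[le_j lt_j]].
  by rewrite sum_nat_const_nat -mulnBl subSnn mul1n.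
have q_gt0 : (0 < q)%N by case: q le_j lt_j => //; rewrite !muln0.
congr F; apply/eqP; rewrite eqn_leq leq_divRL // le_j andbT.
by rewrite -ltnS ltn_divLR.
Qed.

Lemma row_ones_keep_first (d k : nat) (x : 'M[bool]_(d, k)) (i : 'I_d) :
  row_ones (keep_first_ones x) i = [exists j, x i j].
Proof.
rewrite row_onesE; case: (boolP [exists j, x i j]) => [/existsP[j0 xij0] | no_one].
  case: (arg_minnP (fun j : 'I_k => j : nat) xij0) => j xij j_min.
  apply/eqP/cards1P; exists j; apply/setP => j'; rewrite !inE mxE.
  apply/andP/eqP => [[xij' /existsPn first_j'] | ->].
    apply/val_inj/eqP; rewrite /= eqn_leq j_min // andbT leqNgt.
    by apply/negP => lt_j; move: (first_j' j); rewrite lt_j xij.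
  split=> //; apply/existsPn => j''; rewrite negb_and -leqNgt.
  by apply/orP; case: (boolP (x i j'')) => [/j_min|]; [left | right].
apply/eqP; rewrite cards_eq0; apply/eqP/setP => j; rewrite !inE mxE.
by move/existsPn: no_one => /(_ j) /negbTE ->.
Qed.

(** * The greedy algorithm and its ratio *)

Definition covers (d : nat) (xs : seq 'cV[bool]_d) (i : 'I_d) : bool :=
  has (fun x : 'cV[bool]_d => x i ord0) xs.

(** The DUP value of [xs] once repeated ones are removed: every covered row counts once. *)
Definition covered_weight (d : nat) (w : 'cV[int]_d) (xs : seq 'cV[bool]_d) : int :=
  \sum_i w i ord0 * (covers xs i)%:R.

Lemma entry_dot_colE (d : nat) (w : 'cV[int]_d) (x : 'cV[bool]_d) :
  entry_dot w x = \sum_i w i ord0 * (x i ord0)%:R.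
Proof. by apply: eq_bigr => i _; rewrite big_ord1. Qed.

Lemma size_greedy_answers (d : nat) (oracle : 'cV[int]_d -> 'cV[bool]_d)
    (w : 'cV[int]_d) (k : nat) : size (greedy_answers oracle w k) = k.
Proof. by elim: k => //= k IH; rewrite size_rcons IH. Qed.

Lemma greedy_answers_in (d : nat) (S : {set 'cV[bool]_d})
    (oracle : 'cV[int]_d -> 'cV[bool]_d) (w : 'cV[int]_d) (k : nat) :
  linear_opt_oracle S oracle -> {subset greedy_answers oracle w k <= S}.
Proof.
move=> oracleP; elim: k => [|k IH] x //=; rewrite mem_rcons inE => /predU1P[-> | /IH //].
by case: (oracleP (uncovered_weights w (greedy_answers oracle w k))).
Qed.

Lemma row_ones_dup_greedy (d : nat) (oracle : 'cV[int]_d -> 'cV[bool]_d)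
    (w : 'cV[int]_d) (k : nat) (i : 'I_d) :
  row_ones (dup_greedy oracle w k) i = covers (greedy_answers oracle w k) i.
Proof.
rewrite row_ones_keep_first; congr (nat_of_bool _).
apply/existsP/(has_nthP (const_mx false)) => [[j] | [j lt_j xj]].
  by rewrite mxE => xj; exists j; rewrite ?size_greedy_answers.
rewrite size_greedy_answers in lt_j.
by exists (Ordinal lt_j); rewrite mxE.
Qed.

Lemma covered_weight_rcons (d : nat) (w : 'cV[int]_d) (xs : seq 'cV[bool]_d)
    (x : 'cV[bool]_d) :
  covered_weight w (rcons xs x)
  = covered_weight w xs + entry_dot (uncovered_weights w xs) x.
Proof.
rewrite entry_dot_colE -big_split /=; apply: eq_bigr => i _.
rewrite mxE /covers has_rcons; case: has; case: (x i ord0) => /=; ring.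
Qed.

(** A row covered by [zs] but not by [xs] keeps its full weight in [uncovered_weights w xs] and lies
    in some [z]; as weights are nonnegative, counting it several times only increases the right
    side. *)
Lemma missing_weight_le (d : nat) (w : 'cV[int]_d) (xs zs : seq 'cV[bool]_d) :
  (forall i, 0 <= w i ord0) ->
  covered_weight w zs - covered_weight w xs
  <= \sum_(z <- zs) entry_dot (uncovered_weights w xs) z.
Proof.
move=> w_ge0; under eq_bigr do rewrite entry_dot_colE.
rewrite exchange_big -sumrB; apply: ler_sum => i _ /=.
rewrite -mulr_sumr mxE -/(covers xs i); have := w_ge0 i.
case: (covers xs i) => wi_ge0.
  by rewrite mul0r; case: (covers zs i) => /=; lra.
rewrite mulr0 subr0; apply: ler_wpM2l => //.
elim: zs => [|z zs IH]; rewrite ?big_nil ?big_cons /covers //=.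
have : 0 <= \sum_(j <- zs) (j i ord0)%:R :> int by apply: sumr_ge0.
move: IH; rewrite /covers; case: (z i ord0) => /=; case: has => /=; lra.
Qed.

(** Against [k.+1] competitors, each round leaves a gap of at most [k / k.+1] times the previous
    one; denominators are cleared to stay in [int]. The competitors may overlap, so the columns of
    any feasible matrix can serve. *)
Lemma greedy_ratio (d : nat) (S : {set 'cV[bool]_d})
    (oracle : 'cV[int]_d -> 'cV[bool]_d) (w : 'cV[int]_d)
    (zs : seq 'cV[bool]_d) (k r : nat) :
  linear_opt_oracle S oracle -> (forall i, 0 <= w i ord0) ->
  {subset zs <= S} -> size zs = k.+1 ->
  k.+1%:R ^+ r * (covered_weight w zs - covered_weight w (greedy_answers oracle w r))
  <= k%:R ^+ r * covered_weight w zs.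
Proof.
move=> oracleP w_ge0 zsS size_zs; elim: r => [|r IH] /=.
  rewrite !expr0 !mul1r gerBl /covered_weight.
  by apply: sumr_ge0 => i _; rewrite mulr0.
rewrite covered_weight_rcons.
set xs := greedy_answers oracle w r in IH *.
set u := uncovered_weights w xs.
(* No competitor gains more on the current weights [u] than the oracle's answer. *)
have step : covered_weight w zs - covered_weight w xs
            <= k.+1%:R * entry_dot u (oracle u).
  apply: le_trans (missing_weight_le xs zs w_ge0) _.
  rewrite -size_zs mulr_natl -/u.
  have -> : entry_dot u (oracle u) *+ size zs = \sum_(z <- zs) entry_dot u (oracle u).
    by rewrite big_const_seq count_predT iter_addr_0.
  rewrite big_seq [leRHS]big_seq; apply: ler_sum => z /zsS zS.
  by case: (oracleP u) => _; apply.
have {}step : k.+1%:R * (covered_weight w zs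
      - (covered_weight w xs + entry_dot u (oracle u)))
    <= k%:R * (covered_weight w zs - covered_weight w xs).
  by rewrite -natr1 in step *; lra.
rewrite exprSr -mulrA.
apply: le_trans (ler_wpM2l (exprn_ge0 _ (ler0n _ _)) step) _.
by rewrite mulrCA exprS -mulrA; apply: ler_wpM2l.
Qed.

(** * DUP weights, cleaning and the values of the candidates *)

Lemma prefix_sum0 (d n : nat) (c : 'M[int]_(d, n)) (i : 'I_d) : prefix_sum c i 0 = 0.
Proof. by rewrite /prefix_sum big_pred0. Qed.

Lemma dup_weights_ge0 (d n : nat) (c : 'M[int]_(d, n)) (q : nat) (i : 'I_d) :
  0 <= dup_weights c q i ord0.
Proof. by rewrite mxE; apply: bigmax_ge_id. Qed.

Lemma prefix_sum_le_dup_weights (d n : nat) (c : 'M[int]_(d, n)) (q r : nat) (i : 'I_d) :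
  (r <= q)%N -> prefix_sum c i r <= dup_weights c q i ord0.
Proof.
move=> le_rq; rewrite mxE.
exact: (le_bigmax 0 (fun r : 'I_q.+1 => prefix_sum c i r) (Ordinal (le_rq : (r < q.+1)%N))).
Qed.

Lemma dup_weights_le (d n : nat) (c : 'M[int]_(d, n)) (q : nat) (i : 'I_d) (b : int) :
  (forall r : nat, (r <= q)%N -> prefix_sum c i r <= b) -> dup_weights c q i ord0 <= b.
Proof.
move=> bP; rewrite mxE; apply: bigmax_le => [|r _].
  by have := bP 0%N isT; rewrite prefix_sum0.
by apply: bP; rewrite -ltnS.
Qed.

Lemma le_dup_weights (d n : nat) (c : 'M[int]_(d, n)) (q q' : nat) (i : 'I_d) :
  (q <= q')%N -> dup_weights c q i ord0 <= dup_weights c q' i ord0.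
Proof.
move=> le_q; apply: dup_weights_le => r le_r.
exact/prefix_sum_le_dup_weights/(leq_trans le_r).
Qed.

(** Cleaning leaves exactly [p] ones in the row, and [p] attains the largest prefix sum among
    lengths up to the former count. *)
Lemma cleaning_row_ones (d n : nat) (c : 'M[int]_(d, n)) (x y : 'M[bool]_(d, n))
    (i : 'I_d) :
  cleaning c x y -> prefix_sum c i (row_ones y i) = dup_weights c (row_ones x i) i ord0.
Proof.
move=> /(_ i)[p [le_p p_max y_le cardE]].
have -> : row_ones y i = p.
  have : (row_ones x i = row_ones y i + #|[set j | x i j && ~~ y i j]|)%N.
    rewrite !row_onesE -(cardsID [set j | y i j] [set j | x i j]).
    congr (_ + _)%N; apply: eq_card => j; rewrite !inE; last by rewrite andbC.
    by have := y_le j; case: (y i j) => [/= ->|] //; rewrite andbF.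
  by rewrite cardE => e; move: le_p e; lia.
by apply: le_anti; rewrite prefix_sum_le_dup_weights //= dup_weights_le.
Qed.

(** After copying, a covered row has exactly [2 ^ l] ones, so cleaning brings it to its DUP weight;
    an uncovered row has none and is worth 0. *)
Lemma candidate_obj (d k l : nat) (oracle : 'cV[int]_d -> 'cV[bool]_d)
    (c y : 'M_(d, k * 2 ^ l)) :
  candidate oracle c y ->
  sco_obj c y = covered_weight (dup_weights c (2 ^ l))
                  (greedy_answers oracle (dup_weights c (2 ^ l)) k).
Proof.
move=> yP; rewrite sco_objE; apply: eq_bigr => i _.
rewrite (cleaning_row_ones _ yP) row_ones_copy_cols row_ones_dup_greedy.
case: covers; rewrite ?muln1 ?mulr1 // muln0 mulr0.
apply: le_anti; rewrite dup_weights_ge0 andbT; apply: dup_weights_le => r.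
by rewrite leqn0 => /eqP ->; rewrite prefix_sum0.
Qed.

(** Keeping first ones and cleaning only delete ones, so each column lies below an oracle answer. *)
Lemma candidate_in (d k l : nat) (S : {set 'cV[bool]_d})
    (oracle : 'cV[int]_d -> 'cV[bool]_d) (c y : 'M_(d, k * 2 ^ l)) :
  independence_system S -> linear_opt_oracle S oracle ->
  candidate oracle c y -> all_cols_in S y.
Proof.
move=> [_ down] oracleP yP; apply/forallP => j.
set w := dup_weights c (2 ^ l) in yP *.
apply: (down _ (nth (const_mx false) (greedy_answers oracle w k) (j %/ 2 ^ l)%N)).
  move=> i; rewrite mxE; have [p [_ _ /(_ j)]] := yP i.
  by case: (y i j) => //=; rewrite !mxE /= => /andP[].
apply: (@greedy_answers_in _ _ _ w k oracleP); rewrite mem_nth // size_greedy_answers.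
exact: copied_col_subproof.
Qed.

Lemma cleaning_exists (d n : nat) (c : 'M[int]_(d, n)) (x : 'M[bool]_(d, n)) :
  exists y, cleaning c x y.
Proof.
suff /fin_all_exists[A AP] : forall i, exists A : {set 'I_n}, exists p : nat,
    [/\ (p <= row_ones x i)%N,
        forall r : nat, (r <= row_ones x i)%N -> prefix_sum c i r <= prefix_sum c i p,
        A \subset [set j | x i j] & #|A| = (row_ones x i - p)%N].
  exists (\matrix_(i, j) (x i j && (j \notin A i))) => i.
  have [p [le_p p_max /subsetP sub_A cardA]] := AP i.
  exists p; split=> [//|//|j|]; first by rewrite mxE; apply/implyP => /andP[].
  rewrite -cardA; apply: eq_card => j; rewrite !inE mxE negb_and negbK andb_orr.
  rewrite andbN /=; apply/andP/idP => [[] // | jA].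
  by split=> //; have := sub_A j jA; rewrite inE.
move=> i.
pose m := row_ones x i.
have [p _ p_max] := @arg_maxP _ _ _ ord0 predT (fun p : 'I_m.+1 => prefix_sum c i p) isT.
(* Which ones are deleted is free; here the first [m - p] of the row. *)
pose s := take (m - p) (enum [set j | x i j]).
exists [set j in s], p; split.
- by rewrite -ltnS.
- by move=> r le_r; apply: (p_max (Ordinal (le_r : (r < m.+1)%N))).
- by apply/subsetP => j; rewrite inE => /mem_take; rewrite mem_enum.
- rewrite cardsE (card_uniqP _) ?take_uniq ?enum_uniq // size_take -cardE -row_onesE.
  by rewrite -/m; case: ltnP => //; lia.
Qed.

Lemma sco4_output_exists (d : nat) (oracle : 'cV[int]_d -> 'cV[bool]_d)
    (c : 'M[int]_(d, 4)) : exists y, sco4_output oracle c y.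
Proof.
have [y0 y0P] : exists y, @candidate d 4 0 oracle c y by exact: cleaning_exists.
have [y1 y1P] : exists y, @candidate d 2 1 oracle c y by exact: cleaning_exists.
have [y2 y2P] : exists y, @candidate d 1 2 oracle c y by exact: cleaning_exists.
pose Y (j : 'I_3) := nth y0 [:: y0; y1; y2] j.
have [j _ j_max] := @arg_maxP _ _ _ ord0 predT (fun j => sco_obj c (Y j)) isT.
exists (Y j), y0, y1, y2; split=> //; first exact: mem_nth.
move=> y /(nthP y0)[k lt_k <-]; exact: (j_max (Ordinal lt_k)).
Qed.

(** * Averaging over the columns of a feasible matrix *)

Lemma row_inequality (d : nat) (c : 'M[int]_(d, 4)) (z : 'M[bool]_(d, 4)) (i : 'I_d)
    (z0 := z i (inord 0)) (z1 := z i (inord 1)) (z2 := z i (inord 2))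
    (z3 := z i (inord 3)) (w := fun q => dup_weights c q i ord0) :
  15 * prefix_sum c i (row_ones z i) <=
    7 * (w 1%N * [|| z0, z1, z2 | z3]%:R)
    + (w 2%N * (z0 || z1)%:R + w 2%N * (z0 || z2)%:R + w 2%N * (z0 || z3)%:R
       + w 2%N * (z1 || z2)%:R + w 2%N * (z1 || z3)%:R + w 2%N * (z2 || z3)%:R)
    + 5 * (w 4%N * z0%:R + w 4%N * z1%:R + w 4%N * z2%:R + w 4%N * z3%:R).
Proof.
have -> : row_ones z i = (z0 + z1 + z2 + z3)%N.
  rewrite /row_ones !big_ord_recr big_ord0 /= add0n /z0 /z1 /z2 /z3.
  by congr (_ + _ + _ + _)%N; congr (nat_of_bool (z i _)); apply: val_inj;
    rewrite /= inordK.
have w1_ge0 : 0 <= w 1%N by apply: dup_weights_ge0.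
have w12 : w 1%N <= w 2%N by apply: le_dup_weights.
have w24 : w 2%N <= w 4%N by apply: le_dup_weights.
have f1 : prefix_sum c i 1 <= w 1%N by apply: prefix_sum_le_dup_weights.
have f2 : prefix_sum c i 2 <= w 2%N by apply: prefix_sum_le_dup_weights.
have f3 : prefix_sum c i 3 <= w 4%N by apply: prefix_sum_le_dup_weights.
have f4 : prefix_sum c i 4 <= w 4%N by apply: prefix_sum_le_dup_weights.
have f0 := prefix_sum0 c i.
(* For a single one, the [7 + 3 + 5 = 15] weights are all at least [w 1]. For two ones, 5 pairs and
   [5 * 2] from single columns give 15 weights at least [w 2]. For three or four, the single columns
   alone give at least [15 * w 4]. *)
by case: z0 z1 z2 z3 => [] [] [] [] /=; rewrite ?addn0 ?add0n ?addn1 /=; lra.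
Qed.

(** [T] is the weight covered by the competitors, [G] by the greedy answers, and [Y] is the output
    value; [175 = 4 ^ 4 - 3 ^ 4]. *)
Lemma greedy_ratio4_arith (T G Y : int) :
  4 ^+ 4 * (T - G) <= 3 ^+ 4 * T -> G <= Y -> 175 * T <= 256 * Y.
Proof. lra. Qed.

Lemma greedy_ratio2_arith (T G Y : int) :
  2 ^+ 2 * (T - G) <= 1 ^+ 2 * T -> G <= Y -> 3 * T <= 4 * Y.
Proof. lra. Qed.

Lemma greedy_ratio1_arith (T G Y : int) :
  1 ^+ 1 * (T - G) <= 0 ^+ 1 * T -> G <= Y -> T <= Y.
Proof. lra. Qed.

(** Multiplying by 175 clears all ratios: [2625 = 15 * 175] and [6692 = 7 * 256 + 6 * 175 * 4 / 3 +
    5 * 4 * 175]. *)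
Lemma averaging_arith (v Y t p01 p02 p03 p12 p13 p23 s0 s1 s2 s3 : int) :
  15 * v <= 7 * t + (p01 + p02 + p03 + p12 + p13 + p23) + 5 * (s0 + s1 + s2 + s3) ->
  175 * t <= 256 * Y ->
  3 * p01 <= 4 * Y -> 3 * p02 <= 4 * Y -> 3 * p03 <= 4 * Y ->
  3 * p12 <= 4 * Y -> 3 * p13 <= 4 * Y -> 3 * p23 <= 4 * Y ->
  s0 <= Y -> s1 <= Y -> s2 <= Y -> s3 <= Y ->
  2625 * v <= 6692 * Y.
Proof. lra. Qed.

Lemma ratio_of_int (a b : int) :
  2625 * a <= 6692 * b -> (2625%:R / 6692%:R : rat) * a%:~R <= b%:~R.
Proof. by rewrite -(ler_int rat) !intrM; lra. Qed.

Theorem theorem5p6 (d : nat) (S : {set 'cV[bool]_d})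
    (oracle : 'cV[int]_d -> 'cV[bool]_d) (c : 'M[int]_(d, 4))
    (hS : independence_system S) (horacle : linear_opt_oracle S oracle) :
  (exists y : 'M[bool]_(d, 4), sco4_output oracle c y) /\
  (forall y : 'M[bool]_(d, 4), sco4_output oracle c y ->
     all_cols_in S y /\
     (2625%:R / 6692%:R : rat) * (sco_opt S c)%:~R <= (sco_obj c y)%:~R).
Proof.
split; first exact: sco4_output_exists.
move=> y [y0 [y1 [y2 [y0P y1P y2P y_in y_max]]]]; split.
  by move: y_in; rewrite !inE => /or3P[] /eqP ->;
    [exact: (@candidate_in d 4 0 _ _ _ _ hS horacle y0P)
    |exact: (@candidate_in d 2 1 _ _ _ _ hS horacle y1P)
    |exact: (@candidate_in d 1 2 _ _ _ _ hS horacle y2P)].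
have le0 : covered_weight (dup_weights c 1) (greedy_answers oracle (dup_weights c 1) 4)
    <= sco_obj c y.
  rewrite -[leLHS](@candidate_obj d 4 0 _ _ _ y0P); apply: y_max.
  by rewrite !inE eqxx.
have le1 : covered_weight (dup_weights c 2) (greedy_answers oracle (dup_weights c 2) 2)
    <= sco_obj c y.
  rewrite -[leLHS](@candidate_obj d 2 1 _ _ _ y1P); apply: y_max.
  by rewrite !inE eqxx !orbT.
have le2 : covered_weight (dup_weights c 4) (greedy_answers oracle (dup_weights c 4) 1)
    <= sco_obj c y.
  rewrite -[leLHS](@candidate_obj d 1 2 _ _ _ y2P); apply: y_max.
  by rewrite !inE eqxx !orbT.
apply: ratio_of_int.
(* This handles the starting value 0 of the maximum in [sco_opt]. *)
have Y_ge0 : 0 <= sco_obj c y.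
  apply: le_trans le2; apply: sumr_ge0 => i _.
  by rewrite mulr_ge0 ?dup_weights_ge0.
(* The bound is stable under [Num.max], so comparing with one feasible [z] at a time suffices. *)
apply: (big_ind (fun b => 2625 * b <= 6692 * sco_obj c y)) => [|a b|z /forallP zS].
- by rewrite mulr0 mulr_ge0.
- by case: (leP a b).
pose col_ j := col (inord j : 'I_4) z.
have T0 : 175 * covered_weight (dup_weights c 1)
    [:: col_ 0%N; col_ 1%N; col_ 2%N; col_ 3%N] <= 256 * sco_obj c y.
  apply: greedy_ratio4_arith le0.
  (* The argument 3 stands for [3.+1] competitors, the argument 4 for four rounds. *)
  apply: (@greedy_ratio d S oracle _ _ 3 4) => //; first exact: dup_weights_ge0.
  by apply/allP; rewrite /= !zS.
have T1 j k : 3 * covered_weight (dup_weights c 2) [:: col_ j; col_ k]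
    <= 4 * sco_obj c y.
  apply: greedy_ratio2_arith le1.
  apply: (@greedy_ratio d S oracle _ _ 1 2) => //; first exact: dup_weights_ge0.
  by apply/allP; rewrite /= !zS.
have T2 j : covered_weight (dup_weights c 4) [:: col_ j] <= sco_obj c y.
  apply: greedy_ratio1_arith le2.
  apply: (@greedy_ratio d S oracle _ _ 0 1) => //; first exact: dup_weights_ge0.
  by apply/allP; rewrite /= !zS.
have rows : 15 * sco_obj c z <=
   7 * covered_weight (dup_weights c 1) [:: col_ 0%N; col_ 1%N; col_ 2%N; col_ 3%N]
   + (covered_weight (dup_weights c 2) [:: col_ 0%N; col_ 1%N]
      + covered_weight (dup_weights c 2) [:: col_ 0%N; col_ 2%N]
      + covered_weight (dup_weights c 2) [:: col_ 0%N; col_ 3%N]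
      + covered_weight (dup_weights c 2) [:: col_ 1%N; col_ 2%N]
      + covered_weight (dup_weights c 2) [:: col_ 1%N; col_ 3%N]
      + covered_weight (dup_weights c 2) [:: col_ 2%N; col_ 3%N])
   + 5 * (covered_weight (dup_weights c 4) [:: col_ 0%N]
      + covered_weight (dup_weights c 4) [:: col_ 1%N]
      + covered_weight (dup_weights c 4) [:: col_ 2%N]
      + covered_weight (dup_weights c 4) [:: col_ 3%N]).
  (* Merging all sums into one over the rows reduces the bound to a single row. *)
  rewrite sco_objE /covered_weight -!big_split /= !mulr_sumr -!big_split /=.
  apply: ler_sum => i _; rewrite /covers /= !orbF ![col _ z i ord0]mxE.
  exact: row_inequality.
exact: (averaging_arith rows T0).
Qed.
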